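(* Let $V=\{f_1=\cdots=f_r=0\}\subset(\mathbb C^\ast)^n$ be a smooth complete intersection of codimension $r$ with $n\ge 2r$, and put $c=n-2r+1$. Fix a row set $I\subset\{1,\dots,n\}$ and a column set $J\subset\{1,\dots,2r\}$, both of cardinality $2r-1$, and let $U_{I,J}=\{z\in V:\det\mathcal M_f(z)_{I,J}\ne0\}$ be the open set where the chosen pivot minor does not vanish. Then on $U_{I,J}$ the critical locus of $\operatorname{Log}|_V$ is cut out inside $V$ by the $c=n-2r+1$ equations $\Delta_{I,1}(z)=\cdots=\Delta_{I,c}(z)=0$; that is, $$\operatorname{Crit}(\operatorname{Log}|_V)\cap U_{I,J}=\{z\in U_{I,J}:\Delta_{I,1}(z)=\cdots=\Delta_{I,c}(z)=0\}.$$
   Context: $\operatorname{Log}:(\mathbb C^\ast)^n\to\mathbb R^n$ is $\operatorname{Log}(z)=(\log|z_1|,\dots,\log|z_n|)$. The $f_j$ are Laurent polynomials; $V$ is a smooth complete intersection of codimension $r$ means that $df_1,\dots,df_r$ are $\mathbb C$-linearly independent at every point of $V$. $\operatorname{Crit}(\operatorname{Log}|_V)$ is the set of $z\in V$ at which the real rank of $d_z(\operatorname{Log}|_V):T_zV\to\mathbb R^n$ is less than $n$. Let $g_{ji}(z)=z_i\,\partial f_j/\partial z_i(z)=u_{ji}(z)+i\,v_{ji}(z)$ with $u_{ji},v_{ji}$ real, $1\le j\le r$, $1\le i\le n$. $\mathcal M_f(z)$ is the real $n\times 2r$ matrix whose $i$-th row is $(v_{1i},\dots,v_{ri},u_{1i},\dots,u_{ri})$,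 and $\mathcal M_f(z)_{I,J}$ is its submatrix with rows $I$ and columns $J$. Let $k_1,\dots,k_c$ be the elements of $\{1,\dots,n\}\setminus I$. For $1\le\mu\le c$, $\Delta_{I,\mu}(z)$ is the determinant (up to sign) of the $2r\times2r$ submatrix of $\mathcal M_f(z)$ with rows $I\cup\{k_\mu\}$ and all $2r$ columns. *)

(* Defs.v *)
From mathcomp Require Import all_boot all_order all_algebra.
From mathcomp Require Import finmap.
From mathcomp Require Import all_classical all_reals all_analysis.
From mathcomp Require Import complex.

Set Implicit Arguments.
Unset Strict Implicit.
Unset Printing Implicit Defensive.

Import Order.TTheory GRing.Theory Num.Theory.
Import numFieldNormedType.Exports.
Local Open Scope classical_set_scope.
Local Open Scope ring_scope.

(* The finitely supported function [f] stands for the Laurent polynomial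
   sum_a f(a) z^a, where a ranges over Z^n. *)
Notation laurent R n := {fsfun 'rV[int]_n -> R[i] with 0}.

(* In [z ^ m] the exponent [m] is an integer and [0 ^ m] is total; these
   functions are only meaningful on the torus, where no [z 0 i] vanishes. *)
Definition laurent_eval (R : realType) n (f : laurent R n) (z : 'rV[R[i]]_n)
    : R[i] :=
  \sum_(a <- finsupp f) f a * \prod_k z 0 k ^ a 0 k.

(* The value at [z] of the partial derivative of [f] in the variable z_i,
   differentiating each monomial formally. *)
Definition laurent_partial (R : realType) n (f : laurent R n) (i : 'I_n)
    (z : 'rV[R[i]]_n) : R[i] :=
  \sum_(a <- finsupp f)
    f a * (a 0 i)%:~R * \prod_k z 0 k ^ (a 0 k - (k == i)%:Z).

Definition torus (R : realType) n : set 'rV[R[i]]_n :=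
  [set z | forall i, z 0 i != 0].

Definition zero_locus (R : realType) n r (f : 'I_r -> laurent R n)
    : set 'rV[R[i]]_n :=
  [set z | torus z /\ forall j, laurent_eval (f j) z = 0].

(* Row j is the complex differential df_j at [z]. *)
Definition cjacobian (R : realType) n r (f : 'I_r -> laurent R n)
    (z : 'rV[R[i]]_n) : 'M[R[i]]_(r, n) :=
  \matrix_(j, i) laurent_partial (f j) i z.

Definition smooth_complete_intersection (R : realType) n r
    (f : 'I_r -> laurent R n) : Prop :=
  forall z, zero_locus f z -> row_free (cjacobian f z).

(* The identification of C^n with R^n x R^n, z = x + iy <-> (x, y). *)
Definition realify (R : realType) n (z : 'rV[R[i]]_n) : 'rV[R]_(n + n) :=
  row_mx (map_mx (@complex.Re R) z) (map_mx (@complex.Im R) z).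

Definition complexify (R : realType) n (w : 'rV[R]_(n + n)) : 'rV[R[i]]_n :=
  \row_i Complex (lsubmx w 0 i) (rsubmx w 0 i).

Definition Log (R : realType) n (z : 'rV[R[i]]_n) : 'rV[R]_n :=
  \row_i ln (Normc.normc (z 0 i)).

(* T_z V as a real subspace of R^n x R^n, namely the row space of this matrix:
   the vectors w of C^n such that df_j(w) = 0 at [z] for all j. *)
Definition tangent (R : realType) n r (f : 'I_r -> laurent R n)
    (z : 'rV[R[i]]_n) : 'M[R]_(n + n) :=
  kermx (lin1_mx (fun w : 'rV[R]_(n + n) =>
    realify (complexify w *m (cjacobian f z)^T))).

(* Tangent vectors are rows and [jacobian] acts on the right, so the row space
   of the product is the image of T_z V under the differential of Log. *)
Definition rank_dLog (R : realType) n r (f : 'I_r -> laurent R n)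
    (z : 'rV[R[i]]_n) : nat :=
  \rank (tangent f z *m
         jacobian (fun w : 'rV[R]_(n + n) => Log (complexify w)) (realify z)).

Definition Crit (R : realType) n r (f : 'I_r -> laurent R n)
    : set 'rV[R[i]]_n :=
  [set z | zero_locus f z /\ (rank_dLog f z < n)%N].

Definition loggrad (R : realType) n r (f : 'I_r -> laurent R n) (j : 'I_r)
    (i : 'I_n) (z : 'rV[R[i]]_n) : R[i] :=
  z 0 i * laurent_partial (f j) i z.

Definition Mf (R : realType) n r (f : 'I_r -> laurent R n) (z : 'rV[R[i]]_n)
    : 'M[R]_(n, r + r) :=
  row_mx (\matrix_(i, j) complex.Im (loggrad f j i z))
         (\matrix_(i, j) complex.Re (loggrad f j i z)).

(* The determinant of the submatrix with rows [I] and columns [J], both taken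
   in increasing order; meaningful only if #|I| = #|J|, in which case
   [conform_mx] merely casts the submatrix to a square one. *)
Definition minor (R : comPzRingType) m n (A : 'M[R]_(m, n)) (I : {set 'I_m})
    (J : {set 'I_n}) : R :=
  \det (conform_mx (0 : 'M[R]_#|I|)
    (mxsub enum_val enum_val A : 'M[R]_(#|I|, #|J|))).

Definition pivot_locus (R : realType) n r (f : 'I_r -> laurent R n)
    (I : {set 'I_n}) (J : {set 'I_(r + r)}) : set 'rV[R[i]]_n :=
  [set z | zero_locus f z /\ minor (Mf f z) I J != 0].

Definition Delta (R : realType) n r (f : 'I_r -> laurent R n) (I : {set 'I_n})
    (k : 'I_n) (z : 'rV[R[i]]_n) : R :=
  minor (Mf f z) (k |: I)%SET [set: 'I_(r + r)]%SET.

(* Main.v *)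
Require Import Defs.
From mathcomp Require Import all_boot all_order all_algebra.
From mathcomp Require Import finmap.
From mathcomp Require Import all_classical all_reals all_analysis.
From mathcomp Require Import complex ring.

(** On the torus, write a tangent vector of C^n at z as v_i = z_i t_i. Then
    d Log (v) = Re t, and v is tangent to V iff sum_i t_i g_ji = 0 for every j.
    Thus d Log restricted to T_z V is the real-linear map t -> Re t on the kernel
    of a real-linear map C^n -> R^(2r), which is onto because V is smooth. Its
    kernel consists of the purely imaginary t = i s with
    sum_i s_i g_ji = 0 for every j, that is, of the real row vectors s with
    s *m Mf f z = 0. Counting dimensions,

      rank (d Log | T_z V) = (2n - 2r) - (n - rank (Mf f z)),

    so z is critical iff Mf f z has rank less than 2r. This is [rank_dLog_Mf].

    Where the pivot minor of size 2r - 1 does not vanish, the rank of Mf f z is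
    at least 2r - 1, and it is exactly 2r - 1 iff each 2r x 2r minor obtained by
    adding one row to the pivot rows vanishes: Kronecker's bordering principle,
    [bordered_minors_rank]. *)

Import Order.TTheory GRing.Theory Num.Theory.
Import numFieldNormedType.Exports.

Local Open Scope classical_set_scope.
Local Open Scope ring_scope.

(** * Bordered minors *)

(** Turns the cast hidden in [minor] into a rank condition once and for all;
    all later arguments about minors are about ranks of submatrices. *)
Lemma minor_neq0 {F : fieldType} {m n : nat} (A : 'M[F]_(m, n))
    (I : {set 'I_m}) (J : {set 'I_n}) : #|I| = #|J| ->
  (minor A I J != 0) =
  (\rank (mxsub enum_val enum_val A : 'M[F]_(#|I|, #|J|)) == #|I|).
Proof.
rewrite /minor; move: (mxsub _ _ A) => /= B eqIJ.
case: _ / eqIJ B => B.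
by rewrite conform_mx_id -unitfE -unitmxE -row_free_unit.
Qed.

Lemma rank_rowsub_le {F : fieldType} {m n p : nat} (g : 'I_p -> 'I_m)
    (A : 'M[F]_(m, n)) : (\rank (rowsub g A) <= \rank A)%N.
Proof. exact/mxrankS/rowsub_sub. Qed.

Lemma rank_mxsub_le {F : fieldType} {m n p q : nat} (g : 'I_p -> 'I_m)
    (h : 'I_q -> 'I_n) (A : 'M[F]_(m, n)) :
  (\rank (mxsub g h A) <= \rank (rowsub g A))%N.
Proof.
by rewrite mxsubcr -mxrank_tr trmx_mxsub -[leqRHS]mxrank_tr rank_rowsub_le.
Qed.

Lemma rank_colsub_setT {F : fieldType} {m n p : nat} (g : 'I_p -> 'I_m)
    (A : 'M[F]_(m, n)) :
  \rank (mxsub g (enum_val : 'I_#|[set: 'I_n]%SET| -> 'I_n) A) =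
  \rank (rowsub g A).
Proof.
apply/eqP; rewrite eqn_leq rank_mxsub_le /=.
pose s (j : 'I_n) := enum_rank_in (finset.in_setT j) j.
suff -> : rowsub g A = mxsub id s (mxsub g enum_val A).
  exact: leq_trans (rank_mxsub_le _ _ _) (rank_rowsub_le _ _).
by apply/matrixP => i j; rewrite !mxE enum_rankK_in ?finset.in_setT.
Qed.

Lemma rowsub_enum_setU1_sub {F : fieldType} {m n : nat} (A : 'M[F]_(m, n))
    (I : {set 'I_m}) (k : 'I_m) :
  (rowsub (enum_val : 'I_#|I| -> 'I_m) A <=
   rowsub (enum_val : 'I_#|(k |: I)%SET| -> 'I_m) A)%MS.
Proof.
pose s (i : 'I_#|I|) := enum_rank_in (setU11 k I) (enum_val i).
apply: (submx_rowsub s) => i /=; rewrite enum_rankK_in //.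
by rewrite !inE enum_valP orbT.
Qed.

Lemma row_sub_rowsub_enum {F : fieldType} {m n : nat} (A : 'M[F]_(m, n))
    (I : {set 'I_m}) (k : 'I_m) : k \in I ->
  (row k A <= rowsub (enum_val : 'I_#|I| -> 'I_m) A)%MS.
Proof.
move=> kI; rewrite -(enum_rankK_in kI kI) -row_rowsub; exact: row_sub.
Qed.

(** Kronecker's bordering principle. The pivot makes the rows in [I]
    independent, so they span a space of dimension [#|I|]; a vanishing bordered
    minor keeps the rows in [k |: I] in a space of that same dimension, which
    is therefore the span of the rows in [I]. Hence every row of [A] lies in
    this span, and the rank cannot exceed [#|I| = n - 1]. *)
Lemma bordered_minors_rank {F : fieldType} {m n : nat} (A : 'M[F]_(m, n))
    (I : {set 'I_m}) (J : {set 'I_n}) :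
  #|I| = #|J| -> #|I|.+1 = n -> minor A I J != 0 ->
  (\rank A < n)%N <->
  (forall k, k \notin I -> minor A (k |: I)%SET [set: 'I_n]%SET = 0).
Proof.
move=> cardIJ cardI; rewrite minor_neq0 // => /eqP rkIJ.
have cardkI k : k \notin I -> #|(k |: I)%SET| = n.
  by move=> kI; rewrite cardsU1 kI.
have minorE k : k \notin I -> (minor A (k |: I)%SET [set: 'I_n]%SET != 0) =
    (\rank (rowsub (enum_val : 'I_#|(k |: I)%SET| -> _) A) == n).
  move=> kI; rewrite minor_neq0 ?cardsT ?card_ord ?cardkI //.
  by rewrite rank_colsub_setT; congr (_ == _); exact: cardkI.
split=> [rkA k kI | minors0].
  apply/eqP/negPn; rewrite minorE // neq_ltn.
  by rewrite (leq_ltn_trans (rank_rowsub_le _ _)).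
set AI := rowsub (enum_val : 'I_#|I| -> _) A.
have rkAI : \rank AI = #|I|.
  apply/eqP; rewrite eqn_leq rank_leq_row -[X in (X <= _)%N]rkIJ.
  exact: rank_mxsub_le.
suff /mxrankS : (A <= AI)%MS by rewrite rkAI -ltnS cardI.
apply/row_subP => k; have [kI|kI] := boolP (k \in I).
  exact: row_sub_rowsub_enum.
set AkI := rowsub (enum_val : 'I_#|(k |: I)%SET| -> _) A.
have rkAkI : (\rank AkI <= #|I|)%N.
  rewrite -ltnS cardI ltn_neqAle rank_leq_col andbT.
  by rewrite -minorE // minors0 // eqxx.
apply: submx_trans (row_sub_rowsub_enum A _ k (setU11 k I)) _.
by rewrite -(mxrank_leqif_sup (rowsub_enum_setU1_sub A I k)) eqn_leq
  mxrankS ?rowsub_enum_setU1_sub //= rkAI.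
Qed.

(** * Ranks of block matrices and of restrictions to kernels *)

(** The map induced by [D] on [ker L] has kernel [ker L] meet [ker D], which is
    the kernel of the pair [(L, D)]; comparing dimensions gives the rank of a
    restriction to a kernel without choosing a basis of that kernel. *)
Lemma rank_kermx_mul {F : fieldType} {N p q : nat} (L : 'M[F]_(N, p))
    (D : 'M[F]_(N, q)) :
  (\rank (kermx L *m D) + \rank L = \rank (row_mx L D))%N.
Proof.
have := mxrank_mul_ker (kermx L) D.
have -> : \rank (kermx L :&: kermx D)%MS = \rank (kermx (row_mx L D)).
  apply: eqmx_rank; apply/rV_eqP => u.
  by rewrite sub_capmx !sub_kermx mul_mx_row row_mx_eq0.
rewrite !mxrank_ker => rkD.
have leL := rank_leq_row L; have leLD := rank_leq_row (row_mx L D).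
apply/eqP; rewrite -(eqn_add2r (N - \rank (row_mx L D))).
by rewrite addnAC rkD subnK // subnKC.
Qed.

(** Subtracting multiples of the last [n] columns clears [A]; exchanging the two
    blocks of columns, which [X] does as well, leaves the blocks [1] and [B] on
    the diagonal. *)
Lemma rank_block_mx1 {F : fieldType} {n m p : nat} (A : 'M[F]_(n, p))
    (B : 'M[F]_(m, p)) :
  \rank (row_mx (col_mx A B) (col_mx 1%:M 0) : 'M[F]_(n + m, p + n)) =
  (n + \rank B)%N.
Proof.
pose X : 'M[F]_(p + n, n + p) := block_mx 0 1%:M 1%:M (- A).
have Xfree : row_free X.
  apply/row_freeP; exists (block_mx A 1%:M 1%:M 0).
  rewrite mulmx_block !mul0mx !mul1mx !mulmx1 !mulmx0 !add0r !addr0 subrr.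
  by rewrite -scalar_mx_block.
rewrite -(mxrankMfree _ Xfree) -block_mxEh mulmx_block.
rewrite !mul0mx !mul1mx !mulmx1 !mulmx0 !add0r !addr0 subrr.
by rewrite rank_diag_block_mx mxrank1.
Qed.

Lemma rank_row_mxN {F : fieldType} {m p q : nat} (A : 'M[F]_(m, p))
    (B : 'M[F]_(m, q)) : \rank (row_mx (- A) B) = \rank (row_mx A B).
Proof.
pose X : 'M[F]_(p + q) := block_mx (- 1%:M) 0 0 1%:M.
have Xfree : row_free X.
  apply/row_freeP; exists X.
  rewrite mulmx_block !mul0mx !mulmx0 !mul1mx !addr0 !add0r.
  by rewrite mulNmx mulmxN mul1mx opprK -scalar_mx_block.
rewrite -(mxrankMfree _ Xfree) mul_row_block !mulmx0 addr0 add0r.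
by rewrite mulmxN !mulmx1 opprK.
Qed.

(** * Complex matrices as real matrices *)

(** The signs are those of right multiplication, since vectors are rows. The
    equations of T_z V and the change of coordinates v_i = z_i t_i are both of
    this form, so that composing them is multiplying complex matrices. *)
Definition realmx {R : realType} {n p : nat} (A : 'M[R[i]]_(n, p))
    : 'M[R]_(n + n, p + p) :=
  block_mx (map_mx (@complex.Re R) A) (map_mx (@complex.Im R) A)
           (- map_mx (@complex.Im R) A) (map_mx (@complex.Re R) A).

Lemma complexifyK {R : realType} {n : nat} :
  cancel (@complexify R n) (@realify R n).
Proof.
by move=> w; rewrite -[RHS]hsubmxK; congr row_mx; apply/rowP => i; rewrite !mxE.
Qed.

Lemma realifyK {R : realType} {n : nat} :
  cancel (@realify R n) (@complexify R n).
Proof.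
by move=> z; apply/rowP => i; rewrite mxE row_mxKl row_mxKr !mxE; case: (z 0 i).
Qed.

Lemma mul_realmx {R : realType} {n p : nat} (A : 'M[R[i]]_(n, p))
    (w : 'rV[R]_(n + n)) :
  w *m realmx A = realify (complexify w *m A).
Proof.
rewrite -[w in LHS]hsubmxK mul_row_block /realify; congr row_mx;
  apply/rowP => j; rewrite !mxE raddf_sum -big_split /=;
  apply: eq_bigr => k _; rewrite !mxE; case: (A k j) => a b /=.
- by rewrite mulrN.
- by rewrite addrC.
Qed.

Lemma lin1_realmx {R : realType} {n p : nat} (A : 'M[R[i]]_(n, p)) :
  lin1_mx (fun w => realify (complexify w *m A)) = realmx A.
Proof. by apply/matrixP => i j; rewrite mxE -mul_realmx -rowE mxE. Qed.

Lemma eq_mulmx_row {R : pzSemiRingType} {m n : nat} (A B : 'M[R]_(m, n)) :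
  (forall u : 'rV_m, u *m A = u *m B) -> A = B.
Proof. by move=> AB; apply/row_matrixP => i; rewrite !rowE AB. Qed.

Lemma realmxM {R : realType} {n p q : nat} (A : 'M[R[i]]_(n, p))
    (B : 'M[R[i]]_(p, q)) :
  realmx (A *m B) = realmx A *m realmx B.
Proof.
by apply: eq_mulmx_row => w; rewrite mulmxA !mul_realmx realifyK mulmxA.
Qed.

Lemma realmx1 {R : realType} {n : nat} : realmx (1%:M : 'M[R[i]]_n) = 1%:M.
Proof. by apply: eq_mulmx_row => w; rewrite mul_realmx !mulmx1 complexifyK. Qed.

Lemma row_full_realmx {R : realType} {n p : nat} (A : 'M[R[i]]_(n, p)) :
  row_full A -> row_full (realmx A).
Proof.
move=> /row_fullP[B BA]; apply/row_fullP; exists (realmx B).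
by rewrite -realmxM BA realmx1.
Qed.

(** * The differential of Log *)

Lemma is_derive_is_diff {R : realType} (g : R -> R) (x d : R) :
  is_derive x 1 g d -> is_diff x g (fun h => h *: d).
Proof.
move=> [/derivable1_diffP gx gd]; apply: DiffDef => //.
by rewrite diff1E // derive1E gd.
Qed.

Lemma is_diff_coord {R : realType} {m n : nat} (M : 'M[R]_(m, n)) i j :
  is_diff M (fun N : 'M[R]_(m, n) => N i j) (fun N => N i j).
Proof.
apply: DiffDef; first exact: differentiable_coord.
have @f : {linear 'M[R]_(m, n) -> R}.
  by exists (fun N : 'M[R]_(_, _) => N i j); do 2![eexists]; do ?[constructor];
     rewrite ?mxE// => ? *; rewrite ?mxE//; move=> ?; rewrite !mxE.
have := diff_lin M ((fun N => @coord_continuous _ m n i j N) : continuous f).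
by [].
Qed.

(** With v_i = a + i b and w_i = x + i y, the chain rule through
    ln (sqrt (x^2 + y^2)) gives (x a + y b) / (x^2 + y^2), which is the real part
    of v_i / w_i. *)
Lemma is_diff_ln_normc {R : realType} {n : nat} (w : 'rV[R]_(n + n))
    (i : 'I_n) : complexify w 0 i != 0 ->
  is_diff w (fun v => ln (Normc.normc (complexify v 0 i)))
    (fun v => complex.Re (complexify v 0 i / complexify w 0 i)).
Proof.
move=> w_neq0.
pose x := w 0 (lshift n i); pose y := w 0 (rshift n i).
have xy_gt0 : 0 < x ^+ 2 + y ^+ 2.
  rewrite lt_neqAle addr_ge0 ?sqr_ge0 // andbT eq_sym.
  apply: contra w_neq0; rewrite paddr_eq0 ?sqr_ge0 // !sqrf_eq0 => /andP[x0 y0].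
  by rewrite !mxE -/x -/y (eqP x0) (eqP y0).
have s_gt0 : 0 < Num.sqrt (x ^+ 2 + y ^+ 2) by rewrite sqrtr_gt0.
have dx := is_diff_coord w 0 (lshift n i).
have dy := is_diff_coord w 0 (rshift n i).
have dln := is_derive_is_diff _ _ _
  (@is_derive1_comp _ (@ln R) Num.sqrt _ _ _
     (is_derive1_ln s_gt0) (is_derive1_sqrt xy_gt0)).
have := is_diff_comp (is_diffD (is_diffX 1 dx) (is_diffX 1 dy)) dln.
rewrite (_ : _ \o _ = (fun v : 'rV[R]_(n + n) =>
    ln (Normc.normc (complexify v 0 i)))); last first.
  by apply/funext => v /=; rewrite !mxE.
move=> dh; apply: is_diff_eq dh _; apply/funext => v /=.
rewrite !mxE /= !fctE /= -/x -/y.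
set s := Num.sqrt _.
have s2 : x ^+ 2 + y ^+ 2 = s ^+ 2 by rewrite sqr_sqrtr // ltW.
have s_neq0 : s != 0 by rewrite gt_eqF.
rewrite s2 /GRing.scale /=; field.
by rewrite s_neq0.
Qed.

(** Locally log |z_i| is the real part of a branch of log z_i, whose
    differential is dz_i / z_i. *)
Lemma mul_jacobian_Log {R : realType} {n : nat} (z : 'rV[R[i]]_n)
    (v : 'rV[R]_(n + n)) : torus z ->
  v *m jacobian (fun w : 'rV[R]_(n + n) => Log (complexify w)) (realify z) =
  \row_i complex.Re (complexify v 0 i / z 0 i).
Proof.
move=> z_torus.
have comp_diff i : is_diff (realify z)
    (fun w => ln (Normc.normc (complexify w 0 i)))
    (fun v => complex.Re (complexify v 0 i / z 0 i)).
  have := @is_diff_ln_normc _ _ (realify z) i.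
  by rewrite realifyK; apply; apply: z_torus.
(* Differentiability of a map into row vectors: expand it on the standard
   basis. *)
have Log_diff :
    differentiable (fun w : 'rV[R]_(n + n) => Log (complexify w)) (realify z).
  rewrite (_ : (fun w => _) = \sum_(i < n) (fun w : 'rV[R]_(n + n) =>
      ln (Normc.normc (complexify w 0 i)) *: delta_mx 0 i)); last first.
    apply/funext => w; rewrite fct_sumE [LHS]row_sum_delta.
    by apply: eq_bigr => i _; rewrite mxE.
  apply: differentiable_sum => i; apply: differentiableZl.
  by case: (comp_diff i).
rewrite -deriveEjacobian // derive_mx; last exact: diff_derivable.
apply/rowP => i; rewrite mxE [RHS]mxE.
rewrite (_ : (fun w => _) =
    (fun w => ln (Normc.normc (complexify w 0 i)))); last first.
  by apply/funext => w; rewrite mxE.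
rewrite deriveE; last by case: (comp_diff i).
by case: (comp_diff i) => _ ->.
Qed.

(** * The critical locus *)

(** The crux. In the coordinates v_i = z_i t_i the equations of T_z V become
    sum_i t_i g_ji = 0 and the differential of [Log] becomes Re t. The real
    2n x (2r + n) matrix of the pair (equations, differential) is then
    [ U V 1 ; -V U 0 ], with U and V the real and imaginary parts of (g_ji); its
    rank is n + rank (-V U), and (-V U) is [Mf] up to the signs of half of its
    columns. Smoothness says that the equations alone have real rank 2r. *)
Lemma rank_dLog_Mf {R : realType} {n r : nat} (f : 'I_r -> laurent R n)
    (z : 'rV[R[i]]_n) :
  torus z -> row_free (cjacobian f z) ->
  (rank_dLog f z + (r + r) = n + \rank (Mf f z))%N.
Proof.
move=> z_torus f_smooth; rewrite /rank_dLog /tangent lin1_realmx.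
set L := realmx (cjacobian f z)^T.
set D := jacobian _ _.
have rkL : \rank L = (r + r)%N.
  apply/eqP/row_full_realmx.
  by rewrite -[row_full _]/(_ == _) mxrank_tr; exact: f_smooth.
rewrite -[X in (_ + X)%N]rkL rank_kermx_mul.
pose P := realmx (diag_mx z).
have P_full : row_full P.
  apply: row_full_realmx; rewrite row_full_unit unitmxE det_diag unitfE.
  by apply/prodf_neq0 => i _; exact: z_torus.
have PL : P *m L = realmx (\matrix_(i, j) loggrad f j i z).
  rewrite -realmxM; congr realmx; apply/matrixP => i j.
  by rewrite mul_diag_mx !mxE.
have PD : P *m D = col_mx 1%:M 0.
  apply: eq_mulmx_row => u; rewrite mulmxA mul_jacobian_Log //.
  rewrite mul_realmx realifyK -[u in RHS]hsubmxK mul_row_col mulmx1 mulmx0 addr0.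
  by apply/rowP => i; rewrite mul_mx_diag !mxE mulfK //; exact: z_torus.
rewrite -(eqmxMfull (row_mx L D) P_full) mul_mx_row PL PD /realmx.
rewrite block_mxEv rank_block_mx1 rank_row_mxN.
congr (n + \rank (row_mx _ _))%N; by apply/matrixP => i j; rewrite !mxE.
Qed.

Theorem proposition2p1 (R : realType) (n r : nat) (f : 'I_r -> laurent R n)
  (r_gt0 : (0 < r)%N) (le_2r_n : (2 * r <= n)%N)
  (V_smooth : smooth_complete_intersection f)
  (I : {set 'I_n}) (J : {set 'I_(r + r)})
  (cardI : #|I| = (2 * r - 1)%N) (cardJ : #|J| = (2 * r - 1)%N)
  (k : 'I_(n - 2 * r + 1) -> 'I_n) (k_inj : injective k)
  (k_enum : [set k mu | mu : 'I_(n - 2 * r + 1)]%SET = (~: I)%SET) :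
  Crit f `&` pivot_locus f I J =
  [set z | pivot_locus f I J z /\
           forall mu : 'I_(n - 2 * r + 1), Delta f I (k mu) z = 0].
Proof.
have cardIJ : #|I| = #|J| by rewrite cardI cardJ.
have cardIS : #|I|.+1 = (r + r)%N.
  by rewrite cardI mul2n -addnn subn1 prednK // addn_gt0 r_gt0.
have rank_lt z : pivot_locus f I J z -> (rank_dLog f z < n)%N <->
    (forall mu, Delta f I (k mu) z = 0).
  move=> [zV pivot].
  have rkE := rank_dLog_Mf f z zV.1 (V_smooth z zV).
  rewrite -(ltn_add2r (r + r)) rkE ltn_add2l.
  have [rk_minors minors_rk] := bordered_minors_rank _ _ _ cardIJ cardIS pivot.
  split=> [/rk_minors minors0 mu | Delta0].
    by apply: minors0; rewrite -finset.in_setC -k_enum imset_f.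
  apply: minors_rk => i; rewrite -finset.in_setC -k_enum => /imsetP[mu _ ->].
  exact: Delta0.
apply/seteqP; split=> z /=.
  by move=> [[_ rk_z] zU]; split=> //; apply/(rank_lt z zU).
by move=> [zU Delta0]; split=> //; split; [case: zU | apply/(rank_lt z zU)].
Qed.
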